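(* Let $\mathcal{U}=\{u_1,\ldots,u_M\}\subset\mathbb{R}\setminus\{0\}$ be a fixed finite set of $M\ge 1$ distinct nonzero reals, $u_{\min}=\min_m|u_m|$, $u_{\max}=\max_m|u_m|$, and let $\sigma^2>0$ be fixed. For integers $N>k\ge1$, let $x$ be uniformly distributed on $\mathcal{X}_k^N(\mathcal{U})$ and $y=x+\omega$ with $\omega\sim\mathcal{N}(0,\sigma_{N/k}^2I_N)$ independent of $x$, where $\sigma_{N/k}^2=\sigma^2/\log(N/k)$. Let $\hat{x}(y)\in\mathbb{R}^N$ be any estimator of $x$ given $y$. Define $$C_0=\frac{\sigma^2}{u_{\max}^2}\Big(1-\frac{u_{\max}^2}{2\sigma^2}\Big),\qquad C_1=\frac{\sigma^2}{2u_{\max}^2}\Big(1-\frac{u_{\max}^2}{2\sigma^2}\Big)^2+\frac{(u_{\max}-u_{\min}/2)^2}{2\sigma^2}.$$ If $\sigma^2>u_{\max}^2/2$, then $$\liminf_{N\to\infty}\frac{1}{k}\Big(\mathbb{E}[\|x-\hat{x}(y)\|_2^2]-\mathbb{E}[\|x\|_2^2]\Big)\ge 0$$ holds in the limit where $k,N\to\infty$ with $\log k/\log N\to\gamma$, for every $$\gamma<\min\Big\{\frac{C_0}{C_0+\sigma^2/(u_{\max}u_{\min})},\ \frac{C_1}{C_1+3},\ \frac12\Big\}.$$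
   Context: For $v\in\mathbb{R}^N$, $\mathcal{S}_v=\{n: v_n\neq0\}$ is its support. $\mathcal{X}_k^N(\mathcal{U})$ denotes the set of $x\in\mathbb{R}^N$ with $|\mathcal{S}_x|=k$ and $x_n\in\mathcal{U}$ for all $n\in\mathcal{S}_x$. An estimator is any (measurable) function $\hat{x}:\mathbb{R}^N\to\mathbb{R}^N$. *)

(* Defs.v *)
From HB Require Import structures.
From mathcomp Require Import all_boot all_order all_algebra.
From mathcomp Require Import all_classical all_reals all_analysis.
Unset Implicit Arguments.
Unset Strict Implicit.
Unset Printing Implicit Defensive.
Import Order.TTheory GRing.Theory Num.Theory.
Import numFieldNormedType.Exports.
Local Open Scope classical_set_scope.
Local Open Scope ring_scope.

Section Defs.
Context {R : realType}.

(* vectors of R^N are N.-tuple R (equipped with the product sigma-algebra) *)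

Definition supp {N : nat} (v : N.-tuple R) : {set 'I_N} :=
  [set i | tnth v i != 0].

Definition Xset (U : seq R) (k N : nat) : set (N.-tuple R) :=
  [set x | #|supp x| = k /\ forall i, i \in supp x -> tnth x i \in U].

Definition vadd (N : nat) (x w : N.-tuple R) : N.-tuple R :=
  [tuple tnth x i + tnth w i | i < N].

Definition sqnorm2 (N : nat) (v : N.-tuple R) : R :=
  \sum_(i < N) tnth v i ^+ 2.

Definition vsub (N : nat) (x w : N.-tuple R) : N.-tuple R :=
  [tuple tnth x i - tnth w i | i < N].

(* E[f(w)] for w ~ N(0, s^2 I_n), s the standard deviation, written as the
   iterated integral against the product of n one-dimensional N(0,s^2) laws. *)
Fixpoint gauss_expect (n : nat) (s : R) :
    (n.-tuple R -> \bar R) -> \bar R :=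
  match n return (n.-tuple R -> \bar R) -> \bar R with
  | 0 => fun f => f [tuple]
  | n'.+1 => fun f =>
      (\int[normal_prob 0 s]_t gauss_expect n' s (fun w => f [tuple of t :: w]))%E
  end.

Definition unif_expect (N : nat) (X : set (N.-tuple R))
    (g : N.-tuple R -> \bar R) : \bar R :=
  ((\sum_(x \in X) g x) * ((\sum_(x \in X) (1 : R))^-1)%:E)%E.

Definition noise_sd (sigma2 : R) (k N : nat) : R :=
  Num.sqrt (sigma2 / ln (N%:R / k%:R)).

Definition mse (U : seq R) (sigma2 : R) (k N : nat)
    (xhat : N.-tuple R -> N.-tuple R) : \bar R :=
  unif_expect N (Xset U k N) (fun x =>
    gauss_expect N (noise_sd sigma2 k N)
      (fun w => (sqnorm2 N (vsub N x (xhat (vadd N x w))))%:E)).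

Definition energy (U : seq R) (k N : nat) : \bar R :=
  unif_expect N (Xset U k N) (fun x => (sqnorm2 N x)%:E).

Definition umax (U : seq R) : R := \big[Num.max/0]_(u <- U) `|u|.
Definition umin (U : seq R) : R := \big[Num.min/umax U]_(u <- U) `|u|.

Definition C0 (U : seq R) (sigma2 : R) : R :=
  sigma2 / umax U ^+ 2 * (1 - umax U ^+ 2 / (2 * sigma2)).

Definition C1 (U : seq R) (sigma2 : R) : R :=
  sigma2 / (2 * umax U ^+ 2) * (1 - umax U ^+ 2 / (2 * sigma2)) ^+ 2
  + (umax U - umin U / 2) ^+ 2 / (2 * sigma2).

End Defs.

(* Main.v *)
Require Import Defs.
From HB Require Import structures.
From mathcomp Require Import all_boot all_order all_algebra.
From mathcomp Require Import all_classical all_reals all_analysis.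
From mathcomp Require Import measurable_realfun ring lra.
Import Order.TTheory GRing.Theory Num.Theory.
Import numFieldNormedType.Exports.
Local Open Scope classical_set_scope.
Local Open Scope ring_scope.

(* Write k for the sparsity, s^2 for the noise variance, A for umax U, and
   expand |x - xhat|^2 - |x|^2 = |xhat|^2 - 2 <x, xhat>. Group the pairs (x, j),
   j in the support of x, according to the (k-1)-sparse vector x' obtained by
   erasing the entry j. Given x', all the candidates x = x' + u e_j are compared
   under the single law of x' + noise, with respect to which x' + u e_j + noise
   has the density l_(j,u) = exp((u w_j - u^2/2) / s^2) in the noise w.
   By AM-GM with weights proportional to S = sum l_(j,u),
     2 u xhat_j l_(j,u) <= S xhat_j^2 / (k M) + k M u^2 l_(j,u)^2 / S,
   where the first terms add up to less than the available |xhat|^2, and, on the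
   event l_(j,u) <= L, the second ones to at most k M A^2 L. Hence no
   concentration of S is needed: only the tails of single Gaussian coordinates
   matter. As s^2 = sigma2 / log(N/k), one can take
   L = (N/k)^((A^2/2 + rho)/sigma2), whose exponent is less than 1 when
   A^2/2 < sigma2, so that the total loss is k o(1) when N/k goes to infinity,
   which gamma < 1/2 ensures. *)

(** * Gaussian expectations *)

Section density.
Context d (T : measurableType d) (R : realType).
Variables (mu nu : {measure set T -> \bar R}) (g : T -> R).
Hypothesis mg : measurable_fun setT g.
Hypothesis g0 : forall x, 0 <= g x.
Hypothesis nuE : forall A, measurable A -> nu A = (\int[mu]_(x in A) (g x)%:E)%E.
Local Open Scope ereal_scope.
Import HBNNSimple.

Lemma integral_density_nnsfun (f : {nnsfun T >-> R}) :
  \int[nu]_x (f x)%:E = \int[mu]_x ((f x)%:E * (g x)%:E).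
Proof.
under [LHS]eq_integral do rewrite fimfunE -fsumEFin//.
rewrite [LHS]ge0_integral_fsum//; last 2 first.
  - by move=> r; exact/measurable_EFinP/measurableT_comp.
  - by move=> n x _; rewrite EFinM nnfun_muleindic_ge0.
under [RHS]eq_integral.
  move=> x xD; rewrite fimfunE -fsumEFin// muleC ge0_mule_fsumr; last first.
    by move=> r; rewrite EFinM nnfun_muleindic_ge0.
  over.
rewrite [RHS]ge0_integral_fsum//; last 2 first.
  - move=> r; apply: emeasurable_funM; first exact/measurable_EFinP.
    by apply/measurable_EFinP; apply/measurableT_comp.
  - move=> n x _; apply: mule_ge0; first by rewrite lee_fin.
    by rewrite EFinM nnfun_muleindic_ge0.
apply: eq_fsbigr => r _.
have -> : \int[mu]_x ((g x)%:E * (r * \1_(f @^-1` [set r]) x)%:E) =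
   \int[mu]_x (r%:E * ((g x)%:E * (\1_(f @^-1` [set r]) x)%:E)).
  by apply: eq_integral => x _; rewrite EFinM muleCA.
have [r0|r0] := leP 0%R r; last first.
  rewrite preimage_nnfun0//.
  by rewrite !integral0_eq//= => x _; rewrite indic0 ?mulr0 ?mule0.
rewrite [RHS]ge0_integralZl//=.
- under eq_integral do rewrite EFinM.
  rewrite ge0_integralZl//=.
  + rewrite integral_indic// setIT nuE//; congr (_ * _).
    rewrite integral_mkcond; apply: eq_integral => x _.
    rewrite patchE indicE; case: ifPn => _ /=; first by rewrite mule1.
    by rewrite mule0.
  + exact/measurable_EFinP.
- apply: emeasurable_funM; exact/measurable_EFinP.
- by move=> x _; rewrite mule_ge0// lee_fin.
Qed.

(** The simple-function case extends to [f] by monotone convergence, applied to both integrals along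
    the same increasing approximations. *)
Lemma integral_density (f : T -> \bar R) : measurable_fun setT f ->
  (forall x, 0 <= f x) ->
  \int[nu]_x f x = \int[mu]_x (f x * (g x)%:E).
Proof.
move=> mf f0.
pose f_ := nnsfun_approx measurableT mf.
transitivity (limn (fun n => \int[nu]_x (f_ n x)%:E)).
  rewrite -monotone_convergence//=.
  - apply: eq_integral => ? /[!inE] xD; apply/esym/cvg_lim => //=.
    exact: cvg_nnsfun_approx.
  - by move=> n; exact/measurable_EFinP/measurable_funTS.
  - by move=> n ? _; rewrite lee_fin.
  - by move=> ? _ ? ? mn; rewrite lee_fin; exact/lefP/nd_nnsfun_approx.
under eq_fun do rewrite integral_density_nnsfun.
rewrite -monotone_convergence//=.
- apply: eq_integral => x _; apply/cvg_lim => //=.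
  by apply: cvgeZr => //; exact: cvg_nnsfun_approx.
- move=> n; apply: emeasurable_funM; exact/measurable_EFinP.
- by move=> n x _; rewrite mule_ge0// lee_fin.
- move=> x _ m n mn; rewrite lee_wpmul2r// ?lee_fin//.
  exact/lefP/nd_nnsfun_approx.
Qed.

End density.

(** * Translation of a one-dimensional Gaussian law *)

Section gauss1.
Context {R : realType}.
Local Open Scope ereal_scope.
Local Notation mu := (@lebesgue_measure R).

(** By uniqueness of Lebesgue measure, comparing the two measures on half-open intervals
    suffices. *)
Lemma lebesgue_measure_shift (v : R) (A : set R) : measurable A ->
  pushforward mu (shift v : R -> measurableTypeR R) A = mu A.
Proof.
move=> mA; apply/esym/lebesgue_measure_unique => //=.
  exact: measurable_funD.
move=> _ _ [[a b]] _ <-; rewrite /pushforward.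
rewrite (_ : _ @^-1` _ = `](a - v)%R, (b - v)%R]%classic); last first.
  apply/seteqP; split => x /=; rewrite !in_itv/= => /andP[h1 h2].
    by rewrite ltrBlDr h1 lerBrDr.
  by rewrite -ltrBlDr h1 -lerBrDr.
rewrite [LHS]lebesgue_measure_itv [RHS]lebesgue_measure_itv/= !lte_fin ltrD2r.
by case: ifP => // _; rewrite -!EFinD; congr EFin; ring.
Qed.

Lemma ge0_integral_lebesgue_shift (v : R) (f : R -> \bar R) :
  measurable_fun [set: R] f -> (forall x, 0 <= f x) ->
  \int[mu]_x f (x + v)%R = \int[mu]_x f x.
Proof.
move=> mf f0.
have mD : measurable_fun [set: R] (shift v : R -> measurableTypeR R).
  exact: measurable_funD.
rewrite -[LHS]/(\int[mu]_(x in (shift v : R -> measurableTypeR R) @^-1` setT)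
  (f \o shift v) x).
rewrite -ge0_integral_pushforward//=.
by apply: eq_measure_integral => //= A mA _; exact: lebesgue_measure_shift.
Qed.

(** This is the density of the normal law of mean [v] and standard deviation [s] with respect to the
    centred one, at the point [t]. *)
Definition likelihood (s v t : R) : R := expR ((v * t - v ^+ 2 / 2) / s ^+ 2).

Lemma measurable_likelihood s v : measurable_fun [set: R] (likelihood s v).
Proof.
apply: measurableT_comp => //; apply: measurable_funM => //.
by apply: measurable_funB => //; exact: measurable_funM.
Qed.

Lemma normal_pdf_shift (s v t : R) : s != 0%R ->
  normal_pdf 0 s (t - v) = (normal_pdf 0 s t * likelihood s v t)%R.
Proof.
move=> s0; rewrite !normal_pdfE// -mulrA; congr *%R.
rewrite /normal_fun /likelihood -expRD; congr expR.
by field.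
Qed.

Lemma ge0_integral_normal_prob (m s : R) (f : R -> \bar R) :
  measurable_fun [set: R] f -> (forall x, 0 <= f x) ->
  \int[normal_prob m s]_t f t = \int[mu]_t (f t * (normal_pdf m s t)%:E).
Proof.
move=> mf f0.
apply: (@integral_density _ _ R mu (normal_prob m s) (normal_pdf m s)) => //.
- exact: measurable_normal_pdf.
- exact: normal_pdf_ge0.
Qed.

(** One-dimensional Cameron-Martin formula: translation invariance of Lebesgue measure moves the
    shift from [f] to the Gaussian density, and the ratio of the two densities is the likelihood. *)
Lemma ge0_integral_normal_shift (s v : R) (f : R -> \bar R) : s != 0%R ->
  measurable_fun [set: R] f -> (forall x, 0 <= f x) ->
  \int[normal_prob 0 s]_t f (t + v)%R =
  \int[normal_prob 0 s]_t ((likelihood s v t)%:E * f t).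
Proof.
move=> s0 mf f0.
have mD : measurable_fun [set: R] (fun x : R => (x + v)%R).
  exact: measurable_funD.
have mlik := measurable_likelihood s v.
have mpdf := measurable_normal_pdf 0 s.
rewrite ge0_integral_normal_prob//; last exact: measurableT_comp.
rewrite ge0_integral_normal_prob//; first last.
- by move=> x; rewrite mule_ge0// lee_fin expR_ge0.
- by apply: emeasurable_funM => //; exact/measurable_EFinP.
rewrite -[RHS](@ge0_integral_lebesgue_shift v).
- apply: eq_integral => t _.
  rewrite -{2}[t](addrK v) normal_pdf_shift//.
  by rewrite EFinM [RHS]muleAC [RHS]muleC; congr *%E; exact: muleC.
- by repeat apply: emeasurable_funM => //; exact/measurable_EFinP.
- by move=> x; rewrite !mule_ge0// lee_fin ?expR_ge0 ?normal_pdf_ge0.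
Qed.

End gauss1.

Lemma emeasurable_big_sum d (T : measurableType d) (R : realType) (I : Type)
    (r : seq I) (P : pred I) (f : I -> T -> \bar R) :
  (forall i, P i -> measurable_fun setT (f i)) ->
  measurable_fun setT (fun x => \sum_(i <- r | P i) f i x)%E.
Proof.
move=> mf; rewrite (_ : (fun x => _) =
    fun x => (\sum_(i <- r) (if P i then f i x else 0))%E); last first.
  by apply/funext => x; rewrite big_mkcond.
by apply: emeasurable_sum => i; case: (boolP (P i)) => // Pi; exact: mf.
Qed.

(** * Calculus of the iterated Gaussian integral *)

Section gauss_expect.
Context {R : realType}.
Variable s : R.
Local Open Scope ereal_scope.

Lemma eq_gauss_expect n (f g : n.-tuple R -> \bar R) :
  f =1 g -> gauss_expect n s f = gauss_expect n s g.
Proof. by move=> /funext ->. Qed.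

Lemma gauss_expect_ge0 n (f : n.-tuple R -> \bar R) :
  (forall w, 0 <= f w) -> 0 <= gauss_expect n s f.
Proof.
elim: n f => [|n IH] f f0 /=; first exact: f0.
by apply: integral_ge0 => t _; apply: IH.
Qed.

(** The parameter space [T] is left arbitrary for the sake of the induction: the head coordinate
    joins the parameter, the induction hypothesis is used on [T * R], and Tonelli's theorem
    integrates that coordinate out. *)
Lemma measurable_gauss_expect d (T : measurableType d) n
    (f : T * n.-tuple R -> \bar R) :
  measurable_fun setT f -> (forall p, 0 <= f p) ->
  measurable_fun setT (fun t => gauss_expect n s (fun w => f (t, w))).
Proof.
elim: n d T f => [|n IH] d T f mf f0 /=.
  by apply: measurableT_comp => //; exact: measurable_fun_pair.
pose F (p : T * R) := gauss_expect n s (fun w => f (p.1, [tuple of p.2 :: w])).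
have mF : measurable_fun setT F.
  apply: (IH _ _ (fun q : (T * R) * n.-tuple R =>
    f (q.1.1, [tuple of q.1.2 :: q.2]))) => //.
  apply: measurableT_comp => //; apply: measurable_fun_pair.
    exact: measurableT_comp.
  by apply: measurable_cons => //; exact: measurableT_comp.
apply: (@measurable_fun_fubini_tonelli_F _ _ _ _ _ (normal_prob 0 s) F) => //.
by move=> p; apply: gauss_expect_ge0.
Qed.

Lemma measurable_gauss_expect_cons n (f : n.+1.-tuple R -> \bar R) :
  measurable_fun setT f -> (forall w, 0 <= f w) ->
  measurable_fun setT (fun t => gauss_expect n s (fun w => f [tuple of t :: w])).
Proof.
move=> mf f0.
apply: (measurable_gauss_expect _ _ _
  (fun q : R * n.-tuple R => f [tuple of q.1 :: q.2])) => //.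
by apply: measurableT_comp => //; exact: measurable_cons.
Qed.

Lemma measurable_consr n (f : n.+1.-tuple R -> \bar R) (t : R) :
  measurable_fun setT f ->
  measurable_fun setT (fun w : n.-tuple R => f [tuple of t :: w]).
Proof. by move=> mf; apply: measurableT_comp => //; exact: measurable_cons. Qed.

Lemma le_gauss_expect n (f g : n.-tuple R -> \bar R) :
  measurable_fun setT f -> measurable_fun setT g ->
  (forall w, 0 <= f w) -> (forall w, f w <= g w) ->
  gauss_expect n s f <= gauss_expect n s g.
Proof.
elim: n f g => [|n IH] f g mf mg f0 fg //=.
have g0 w : 0 <= g w by exact: le_trans (fg w).
apply: ge0_le_integral => //.
- by move=> t _; exact: gauss_expect_ge0.
- exact: measurable_gauss_expect_cons.
- exact: measurable_gauss_expect_cons.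
- by move=> t _; apply: IH => //; exact: measurable_consr.
Qed.

Lemma gauss_expectD n (f g : n.-tuple R -> \bar R) :
  measurable_fun setT f -> measurable_fun setT g ->
  (forall w, 0 <= f w) -> (forall w, 0 <= g w) ->
  gauss_expect n s (fun w => f w + g w) =
  gauss_expect n s f + gauss_expect n s g.
Proof.
elim: n f g => [|n IH] f g mf mg f0 g0 //=.
rewrite -ge0_integralD//.
- by apply: eq_integral => t _; rewrite IH//; exact: measurable_consr.
- by move=> t _; exact: gauss_expect_ge0.
- exact: measurable_gauss_expect_cons.
- by move=> t _; exact: gauss_expect_ge0.
- exact: measurable_gauss_expect_cons.
Qed.

Lemma gauss_expectZl n (c : R) (f : n.-tuple R -> \bar R) : (0 <= c)%R ->
  measurable_fun setT f -> (forall w, 0 <= f w) ->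
  gauss_expect n s (fun w => c%:E * f w) = c%:E * gauss_expect n s f.
Proof.
elim: n f => [|n IH] f c0 mf f0 //=.
rewrite -ge0_integralZl//.
- by apply: eq_integral => t _; rewrite IH//; exact: measurable_consr.
- exact: measurable_gauss_expect_cons.
- by move=> t _; exact: gauss_expect_ge0.
Qed.

Lemma gauss_expect_cst n (c : R) : gauss_expect n s (fun=> c%:E) = c%:E.
Proof.
elim: n => [|n IH] //=; under eq_integral do rewrite IH.
by rewrite integral_cst//= /normal_prob integral_normal_pdf mule1.
Qed.

Lemma gauss_expect_sum n (I : Type) (r : seq I) (P : pred I)
    (f : I -> n.-tuple R -> \bar R) :
  (forall i, P i -> measurable_fun setT (f i)) ->
  (forall i w, P i -> 0 <= f i w) ->
  gauss_expect n s (fun w => \sum_(i <- r | P i) f i w) =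
  \sum_(i <- r | P i) gauss_expect n s (f i).
Proof.
move=> mf f0; elim: r => [|i r IH].
  rewrite big_nil -[RHS](gauss_expect_cst n 0).
  by apply: eq_gauss_expect => w; rewrite big_nil.
rewrite big_cons -IH; case: ifPn => Pi; last first.
  by apply: eq_gauss_expect => w; rewrite big_cons (negbTE Pi).
rewrite -gauss_expectD//.
- by apply: eq_gauss_expect => w; rewrite big_cons Pi.
- exact: mf.
- exact: emeasurable_big_sum.
- by move=> w; exact: f0.
- by move=> w; apply: sume_ge0 => j Pj; exact: f0.
Qed.

Definition vshift n (j : 'I_n) (v : R) (w : n.-tuple R) : n.-tuple R :=
  [tuple if i == j then (tnth w i + v)%R else tnth w i | i < n].

Lemma measurable_vshift n (j : 'I_n) (v : R) :
  measurable_fun setT (vshift n j v).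
Proof.
apply/measurable_fun_tnthP => i.
rewrite (_ : _ \o _ = fun w => if i == j then (tnth w i + v)%R else tnth w i).
  have m : measurable_fun setT (fun w : n.-tuple R => tnth w i).
    exact: measurable_tnth.
  by case: (i == j) => //; exact: measurable_funD.
by apply/funext => w /=; rewrite tnth_mktuple.
Qed.

Lemma vshift_cons0 n v t (w : n.-tuple R) :
  vshift n.+1 ord0 v [tuple of t :: w] = [tuple of (t + v)%R :: w].
Proof.
apply: eq_from_tnth => i; rewrite tnth_mktuple.
case: (unliftP ord0 i) => [k ->|->].
  by rewrite eq_sym (negbTE (neq_lift _ _)) !tnthS.
by rewrite eqxx !tnth0.
Qed.

Lemma vshift_consS n (j : 'I_n) v t (w : n.-tuple R) :
  vshift n.+1 (lift ord0 j) v [tuple of t :: w] = [tuple of t :: vshift n j v w].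
Proof.
apply: eq_from_tnth => i; rewrite tnth_mktuple.
case: (unliftP ord0 i) => [k ->|->].
  by rewrite !tnthS tnth_mktuple (inj_eq (@lift_inj _ _)).
by rewrite (negbTE (neq_lift _ _)) !tnth0.
Qed.

(** Only the integral over coordinate [j] is affected. The induction peels off the coordinates
    before it, until the one-dimensional formula applies to the outermost integral. *)
Lemma gauss_expect_shift n (j : 'I_n) (v : R) (f : n.-tuple R -> \bar R) :
  s != 0%R -> measurable_fun setT f -> (forall w, 0 <= f w) ->
  gauss_expect n s (fun w => f (vshift n j v w)) =
  gauss_expect n s (fun w => (likelihood s v (tnth w j))%:E * f w).
Proof.
move=> s0; elim: n j f => [|n IH] j f mf f0; first by case: j.
case: (unliftP ord0 j) => [k ->|->] /=.
  apply: eq_integral => t _.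
  under eq_gauss_expect do rewrite vshift_consS.
  rewrite (IH k (fun w => f [tuple of t :: w]))//; last exact: measurable_consr.
  by apply: eq_gauss_expect => w; rewrite tnthS.
pose F t := gauss_expect n s (fun w => f [tuple of t :: w]).
transitivity (\int[normal_prob 0 s]_t F (t + v)%R).
  by apply: eq_integral => t _; apply: eq_gauss_expect => w; rewrite vshift_cons0.
rewrite (ge0_integral_normal_shift _ v F)//.
- apply: eq_integral => t _; rewrite -gauss_expectZl ?expR_ge0//.
  exact: measurable_consr.
- exact: measurable_gauss_expect_cons.
- by move=> t; exact: gauss_expect_ge0.
Qed.

End gauss_expect.

(** * The pointwise inequality *)

Section pointwise.
Context {R : realType}.

(* AM-GM: 2 u z l <= c z^2 + u^2 l^2 / c, with l^2 <= L l *)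
Lemma one_term_bound (u z l h k A L c : R) : 2 <= k -> 0 < l -> 0 <= h ->
  `|u| <= A -> 0 <= L -> 0 < c -> l <= L \/ 1 <= h ->
  l * u ^+ 2 <= l * (- k^-1 * z ^+ 2 + (u - z) ^+ 2 + 2 * u ^+ 2 * h)
    + c * z ^+ 2 + A ^+ 2 * L * l / c.
Proof.
move=> k2 l0 h0 uA L0 c0 lh.
have uA2 : u ^+ 2 <= A ^+ 2.
  by rewrite -(real_normK (num_real u)) lerXn2r// nnegrE// (le_trans _ uA).
have k0 : 0 < k by lra.
have kV : k^-1 <= 2^-1 by rewrite lef_pV2 ?posrE.
have z2 : 0 <= z ^+ 2 by exact: sqr_ge0.
have u2 : 0 <= u ^+ 2 by exact: sqr_ge0.
have kz : k^-1 * z ^+ 2 <= 2^-1 * z ^+ 2 by exact: ler_wpM2r.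
have ALc : 0 <= A ^+ 2 * L * l / c.
  apply: divr_ge0; last exact: ltW.
  by apply: mulr_ge0; [apply: mulr_ge0 => //; exact: sqr_ge0|exact: ltW].
have cz : 0 <= c * z ^+ 2 by rewrite mulr_ge0// ltW.
have q2 : 0 <= 1 - k^-1 by lra.
have [h1|h1] := leP 1 h.
  (* On the tail event the term [2 * u ^+ 2 * h] pays for everything: with [h] lowered to [1] and
     [k^-1] raised to one half, the expression is [(z - 2 * u) ^+ 2 / 2]. *)
  have : 0 <= - k^-1 * z ^+ 2 + (u - z) ^+ 2 + 2 * u ^+ 2 * h - u ^+ 2.
    have : 2 * u ^+ 2 <= 2 * u ^+ 2 * h by rewrite ler_peMr// mulr_ge0.
    have : 0 <= (z - 2 * u) ^+ 2 by exact: sqr_ge0.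
    by rewrite mulNr; nra.
  by move/(mulr_ge0 (ltW l0)); rewrite mulrBr; lra.
have {lh} lL : l <= L by case: lh => //; rewrite leNgt h1.
have : 2 * (u * z * l) <= c * z ^+ 2 + A ^+ 2 * L * l / c.
  apply: (@le_trans _ _ (c * z ^+ 2 + u ^+ 2 * l ^+ 2 / c)).
    have : 0 <= (c * z - u * l) ^+ 2 / c.
      by rewrite mulr_ge0 ?sqr_ge0// invr_ge0 ltW.
    rewrite (_ : _ / c = c * z ^+ 2 + u ^+ 2 * l ^+ 2 / c - 2 * (u * z * l)).
      by rewrite subr_ge0.
    by field; rewrite gt_eqF.
  rewrite lerD2l ler_pM2r ?invr_gt0// -mulrA; apply: ler_pM => //.
    exact: sqr_ge0.
  by rewrite expr2 ler_pM2r.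
have : 0 <= l * ((1 - k^-1) * z ^+ 2 + 2 * u ^+ 2 * h).
  apply: mulr_ge0; first exact: ltW.
  by apply: addr_ge0; apply: mulr_ge0 => //; apply: mulr_ge0.
by set X := A ^+ 2 * L * l / c; lra.
Qed.

(** Here [l] plays the likelihoods, [h] a majorant of the indicator of [l > L], and [z] the estimate
    at the free positions. The bound is [one_term_bound] summed over all pairs, with one common
    constant [c]. *)
Lemma pointwise_bound (I J : finType) (T : pred I) (i0 : I) (j0 : J)
    (u : J -> R) (l h : I * J -> R) (z : I -> R) (k A L : R) :
  T i0 -> 2 <= k -> (forall p, 0 < l p) -> (forall p, 0 <= h p) ->
  (forall j, `|u j| <= A) -> 0 <= L -> (forall p, l p <= L \/ 1 <= h p) ->
  \sum_(p | T p.1) l p * u p.2 ^+ 2 <=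
  \sum_(p | T p.1) l p *
     (k^-1 * (\sum_(i | T i && (i != p.1)) z i ^+ 2)
      + (u p.2 - z p.1) ^+ 2 + 2 * u p.2 ^+ 2 * h p)
  + #|J|%:R * k * A ^+ 2 * L.
Proof.
move=> Ti0 k2 l0 h0 uA L0 lh.
have k0 : 0 < k by lra.
pose S := \sum_(p | T p.1) l p; pose Z := \sum_(i | T i) z i ^+ 2.
pose M : R := #|J|%:R.
have S0 : 0 < S.
  rewrite /S (bigD1 (i0, j0))//= ltr_pwDl// sumr_ge0// => p _; exact: ltW.
have M0 : 0 < M by rewrite ltr0n; apply/card_gt0P; exists j0.
(* With this choice the terms [c * z ^+ 2], in which each position occurs [M] times, add up to
   exactly [S * (k^-1 * Z)], while [S / c] is [k * M]. *)
pose c := S / (k * M).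
have c0 : 0 < c by rewrite divr_gt0// mulr_gt0.
have Zc : \sum_(p : I * J | T p.1) c * z p.1 ^+ 2 = S * (k^-1 * Z).
  rewrite (eq_bigl (fun p : I * J => T p.1 && true)); last by move=> p; rewrite andbT.
  rewrite -(pair_big T xpredT (fun i _ => c * z i ^+ 2))/=.
  under eq_bigr do rewrite sumr_const -mulr_natl.
  rewrite -mulr_sumr -mulr_sumr mulrA -/Z -/M.
  rewrite (_ : M * c = S * k^-1) ?mulrA// /c; field.
  by rewrite !gt_eqF.
have Sl : \sum_(p | T p.1) A ^+ 2 * L * l p / c = M * k * A ^+ 2 * L.
  rewrite -mulr_suml -mulr_sumr -/S /c; field.
  by rewrite !gt_eqF.
have SZ : \sum_(p | T p.1) l p * (k^-1 * Z) = S * (k^-1 * Z).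
  by rewrite -mulr_suml.
(* Adding [S * (k^-1 * Z)] to both sides, spread as [l p * (k^-1 * Z)] on the left and as
   [c * z ^+ 2] on the right, reduces the claim to a comparison term by term. *)
rewrite -/M -Sl -(lerD2r (S * (k^-1 * Z))) -{1}SZ -Zc -!big_split /=.
apply: ler_sum => -[i j] /= Ti.
have -> : \sum_(i' | T i' && (i' != i)) z i' ^+ 2 = Z - z i ^+ 2.
  by apply/eqP; rewrite eq_sym subr_eq addrC -bigD1.
have := @one_term_bound (u j) (z i) (l (i, j)) (h (i, j)) k A L c k2 (l0 _)
  (h0 _) (uA _) L0 c0 (lh _).
set X := A ^+ 2 * L * l (i, j) / c; lra.
Qed.

End pointwise.

(** * Sparse vectors over a finite alphabet *)

Section codes.
Context {R : realType}.
Variables (U : seq R) (N : nat).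

(** A zero entry is [None] and a nonzero one is an index into [U]. Codes form a finite type, so that
    averages over [Xset] become ordinary finite sums. *)
Definition sparse_code := {ffun 'I_N -> option 'I_(size U)}.

Definition code_vec (f : sparse_code) : N.-tuple R :=
  [tuple if f i is Some m then U`_m else 0 | i < N].

Definition csupp (f : sparse_code) : {set 'I_N} := [set i | f i != None].

Definition upd (f : sparse_code) (j : 'I_N) (o : option 'I_(size U)) : sparse_code :=
  [ffun i => if i == j then o else f i].

Hypothesis U0 : 0 \notin U.

Lemma supp_code_vec f : supp (code_vec f) = csupp f.
Proof.
apply/setP => i; rewrite !inE tnth_mktuple.
case: (f i) => [m|]; last by rewrite eqxx.
by rewrite (memPn U0)// mem_nth.
Qed.

Lemma code_vec_inj : uniq U -> injective code_vec.
Proof.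
move=> uU f g fg; apply/ffunP => i.
have := congr1 (fun t => tnth t i) fg; rewrite !tnth_mktuple.
have nz (m : 'I_(size U)) : U`_m != 0 by rewrite (memPn U0)// mem_nth.
case: (f i) (g i) => [m|] [m'|] //.
- by move/eqP; rewrite nth_uniq// => /eqP/val_inj ->.
- by move/eqP; rewrite (negbTE (nz m)).
- by move/eqP; rewrite eq_sym (negbTE (nz m')).
Qed.

Lemma mem_code_vec f i : i \in csupp f -> tnth (code_vec f) i \in U.
Proof. by rewrite inE tnth_mktuple; case: (f i) => // m _; exact: mem_nth. Qed.

Lemma code_vec_surj (x : N.-tuple R) :
  (forall i, i \in supp x -> tnth x i \in U) -> exists f, x = code_vec f.
Proof.
(* For a value outside [U], [index] returns [size U] and [insub] gives [None]; such a value has to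
   be zero. *)
move=> xU; exists [ffun i => insub (index (tnth x i) U)].
apply: eq_from_tnth => i; rewrite tnth_mktuple ffunE.
have [xi|xi] := boolP (tnth x i \in U).
  have lt : (index (tnth x i) U < size U)%N by rewrite index_mem.
  by rewrite insubT/= nth_index.
rewrite insubF ?index_mem ?(negbTE xi)//.
by apply/eqP; apply: contraNT xi => xi; apply: xU; rewrite inE.
Qed.

(** [code_vec] is a bijection from the codes with [k] occupied positions onto [Xset U k N]; its
    injectivity uses that the letters are distinct and nonzero. *)
Lemma sum_Xset (V : nmodType) (uU : uniq U) k (F : N.-tuple R -> V) :
  \sum_(x \in Xset U k N) F x = \sum_(f : sparse_code | #|csupp f| == k) F (code_vec f).
Proof.
pose r := [seq code_vec f | f <- enum [pred f : sparse_code | #|csupp f| == k]].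
have -> : Xset U k N = [set` r].
  apply/seteqP; split => x /=.
    move=> [xk xU]; have [f xE] := code_vec_surj x xU.
    apply/mapP; exists f => //; rewrite mem_enum inE -supp_code_vec -xE.
    exact/eqP.
  move=> /mapP[f]; rewrite mem_enum inE => /eqP fk ->; split.
    by rewrite supp_code_vec.
  by rewrite supp_code_vec; exact: mem_code_vec.
rewrite -fsbig_seq; last by rewrite map_inj_uniq ?enum_uniq//; exact: code_vec_inj.
by rewrite big_map big_enum.
Qed.

Lemma card_csupp_upd (f : sparse_code) j m : f j = None ->
  #|csupp (upd f j (Some m))| = #|csupp f|.+1.
Proof.
move=> fj; have -> : csupp (upd f j (Some m)) = j |: csupp f.
  by apply/setP => i; rewrite !inE ffunE; case: (eqVneq i j).
by rewrite cardsU1 inE fj.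
Qed.

(** Erasing position [i] is undone by remembering [i] and its letter: this bijection regroups the
    pairs of a code and a support position by the erased code. *)
Lemma sum_supp_reindex (V : nmodType) k (H : sparse_code -> 'I_N -> V) :
  (0 < size U)%N ->
  \sum_(f : sparse_code | #|csupp f| == k.+1) \sum_(i in csupp f) H f i =
  \sum_(f : sparse_code | #|csupp f| == k)
    \sum_(p : 'I_N * 'I_(size U) | f p.1 == None)
       H (upd f p.1 (Some p.2)) p.1.
Proof.
move=> U_gt0; rewrite !pair_big_dep/=.
(* A default letter for [odflt], returned only at positions outside the support. *)
pose j0 := Ordinal U_gt0.
pose h (q : sparse_code * ('I_N * 'I_(size U))) := (upd q.1 q.2.1 (Some q.2.2), q.2.1).
pose h' (q : sparse_code * 'I_N) := (upd q.1 q.2 None, (q.2, odflt j0 (q.1 q.2))).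
rewrite (reindex_onto h h') /=; last first.
  move=> [f i] /= /andP[_]; rewrite inE => fi; congr pair.
  apply/ffunP => l; rewrite !ffunE; case: eqVneq => // ->.
  by rewrite /=; case: (f i) fi => [m _|/eqP]//.
apply: eq_bigl => -[f [j m]] /=.
rewrite /h' /h /= inE !ffunE eqxx/= andbT.
have [fj|fj] := eqVneq (f j) None.
  rewrite card_csupp_upd// eqSS andbT.
  rewrite (_ : (_, _) == _ = true) ?andbT//; apply/eqP; congr pair.
  by apply/ffunP => l; rewrite !ffunE; case: eqVneq => // ->.
(* If [j] was already occupied in [f], writing there and then erasing leaves [None] at [j], so [f]
   is not recovered. *)
rewrite andbF; apply/negbTE/negP => /andP[_ /eqP [/ffunP/(_ j)]].
by rewrite !ffunE eqxx => /esym; apply/eqP.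
Qed.

Lemma code_vec_upd (f : sparse_code) j m : f j = None ->
  code_vec (upd f j (Some m)) = vshift N j U`_m (code_vec f).
Proof.
move=> fj; apply: eq_from_tnth => i; rewrite !tnth_mktuple ffunE.
by case: eqVneq => // ->; rewrite fj add0r.
Qed.

Lemma sum_csuppE (V : nmodType) (f : sparse_code) (H : 'I_N -> V) :
  (forall i, f i = None -> H i = 0) ->
  \sum_(i in csupp f) H i = \sum_i H i.
Proof.
move=> H0; rewrite [RHS](bigID (fun i => i \in csupp f))/=.
rewrite [X in _ + X]big1 ?addr0// => i; rewrite inE negbK => /eqP; exact: H0.
Qed.

Lemma card_free_pairs (f : sparse_code) :
  #|[pred p : 'I_N * 'I_(size U) | f p.1 == None]| =
  ((N - #|csupp f|) * size U)%N.
Proof.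
have -> : (N - #|csupp f|)%N = #|~: csupp f|.
  by rewrite [RHS]cardsCs finset.setCK card_ord.
rewrite -[in RHS](card_ord (size U)) -[#|'I__|]cardsT -cardsX.
by apply: eq_card => -[i m]; rewrite !inE/= negbK andbT.
Qed.

(** The reindexing applied to the constant [1] counts the same pairs in two ways. *)
Lemma card_code_rec k : (0 < size U)%N ->
  (#|[pred f : sparse_code | #|csupp f| == k.+1]| * k.+1 =
   #|[pred f : sparse_code | #|csupp f| == k]| * ((N - k) * size U))%N.
Proof.
move=> U_gt0; have := sum_supp_reindex nat k (fun _ _ => 1%N) U_gt0.
rewrite (eq_bigr (fun=> k.+1)); last first.
  by move=> f /eqP fk; rewrite sum1_card fk.
rewrite [X in _ = X -> _](eq_bigr (fun=> ((N - k) * size U)%N)); last first.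
  by move=> f /eqP fk; rewrite sum1_card card_free_pairs fk.
by rewrite !sum_nat_const.
Qed.

End codes.

(** * Lower bound on the risk *)

Section tail.
Context {R : realType}.
Variables (s eta rho : R).
Hypothesis s0 : s != 0.

(** Chernoff majorant of the indicator of [v * (t - v) > rho], with free exponent [eta]. *)
Definition tail_weight (v t : R) : R :=
  expR ((eta * v * (t - v) - eta * rho) / s ^+ 2).

(** Since [v * t - v ^+ 2 / 2] equals [v * (t - v) + v ^+ 2 / 2], comparing [v * (t - v)] with [rho]
    decides between the two alternatives. *)
Lemma likelihood_or_tail (A v t : R) : 0 <= eta -> `|v| <= A ->
  likelihood s v t <= expR ((A ^+ 2 / 2 + rho) / s ^+ 2)
  \/ 1 <= tail_weight v t.
Proof.
move=> eta0 vA.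
have s2 : 0 < s ^+ 2 by rewrite exprn_even_gt0.
have [vt|vt] := leP (v * (t - v)) rho; [left|right].
  rewrite ler_expR ler_pM2r ?invr_gt0//.
  have : v ^+ 2 <= A ^+ 2.
    by rewrite -(real_normK (num_real v)) lerXn2r// nnegrE// (le_trans _ vA).
  by lra.
rewrite -expR0 ler_expR divr_ge0 ?(ltW s2)//.
by rewrite -mulrA -mulrBr mulr_ge0// subr_ge0 ltW.
Qed.

Lemma measurable_tail_weight v : measurable_fun [set: R] (tail_weight v).
Proof.
apply: measurableT_comp => //; apply: measurable_funM => //.
by apply: measurable_funB => //; apply: measurable_funM => //;
  exact: measurable_funB.
Qed.

Local Open Scope ereal_scope.

Lemma measurable_comp_tnth n (j : 'I_n) (f : R -> R) :
  measurable_fun [set: R] f ->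
  measurable_fun setT (fun w : n.-tuple R => (f (tnth w j))%:E).
Proof.
move=> mf; apply/measurable_EFinP.
apply: measurableT_comp => //; exact: measurable_tnth.
Qed.

Lemma gauss_expect_likelihood n (j : 'I_n) (v : R) :
  gauss_expect n s (fun w => (likelihood s v (tnth w j))%:E) = 1.
Proof.
rewrite -(gauss_expect_cst s n 1).
rewrite (gauss_expect_shift s n j v (fun=> 1%:E))//.
by apply: eq_gauss_expect => w; rewrite mule1.
Qed.

Lemma gauss_expect_tail n (j : 'I_n) (A v : R) : (`|v| <= A)%R ->
  gauss_expect n s
    (fun w => (likelihood s v (tnth w j) * tail_weight v (tnth w j))%:E)
  <= (expR ((eta ^+ 2 * A ^+ 2 / 2 - eta * rho) / s ^+ 2))%:E.
Proof.
move=> vA.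
have s2 : (0 < s ^+ 2)%R by rewrite exprn_even_gt0.
have vA2 : (v ^+ 2 <= A ^+ 2)%R.
  by rewrite -(real_normK (num_real v)) lerXn2r// nnegrE// (le_trans _ vA).
pose c := expR ((eta ^+ 2 * v ^+ 2 / 2 - eta * rho) / s ^+ 2).
have mtail := measurable_comp_tnth n j (tail_weight v) (measurable_tail_weight v).
have -> : gauss_expect n s
    (fun w => (likelihood s v (tnth w j) * tail_weight v (tnth w j))%:E) = c%:E.
  rewrite -[RHS]mule1 -(gauss_expect_likelihood n j (eta * v)).
  rewrite -gauss_expectZl; last 3 first.
  - exact: expR_ge0.
  - by apply: measurable_comp_tnth; exact: measurable_likelihood.
  - by move=> w; rewrite lee_fin expR_ge0.
  transitivity (gauss_expect n s
      (fun w => (tail_weight v (tnth (vshift n j v w) j))%:E)).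
    rewrite (gauss_expect_shift s n j v (fun w => (tail_weight v (tnth w j))%:E))//.
    by move=> w; rewrite lee_fin expR_ge0.
  (* Once translated, the tail weight is [c] times the likelihood for the shift [eta * v], whose
     mean is [1]. *)
  apply: eq_gauss_expect => w; rewrite tnth_mktuple eqxx -EFinM; congr EFin.
  by rewrite /tail_weight /c /likelihood -expRD; congr expR; ring.
rewrite lee_fin ler_expR ler_pM2r ?invr_gt0// lerD2r ler_pM2r ?invr_gt0//.
by rewrite ler_wpM2l// sqr_ge0.
Qed.

End tail.

(** * Risk at fixed dimension; [k] is the sparsity after one erasure, so signals have [k.+1] nonzero
    entries *)

Section risk.
Context {R : realType}.
Variables (U : seq R) (N k : nat) (s A rho eta : R).
Variable xhat : N.-tuple R -> N.-tuple R.
Hypothesis U0 : 0 \notin U.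
Hypothesis uU : uniq U.
Hypothesis U_gt0 : (0 < size U)%N.
Hypothesis k_gt0 : (0 < k)%N.
Hypothesis kN : (k.+1 < N)%N.
Hypothesis s0 : s != 0.
Hypothesis UA : forall v, v \in U -> `|v| <= A.
Hypothesis eta0 : 0 <= eta.
Hypothesis mxhat : measurable_fun setT xhat.

Local Notation sparse_code := (sparse_code U N).
Local Notation code_vec := (code_vec U N).
Local Notation csupp := (csupp U N).
Local Notation upd := (upd U N).
(** [L] is the truncation level of the likelihoods, and [eps] is the Chernoff bound for exceeding it
    under the shifted law. *)
Let L : R := expR ((A ^+ 2 / 2 + rho) / s ^+ 2).
Let eps : R := expR ((eta ^+ 2 * A ^+ 2 / 2 - eta * rho) / s ^+ 2).

(* The squared error off the support of x is split evenly over the k.+1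
   elements of the support. *)
Definition local_risk (f : sparse_code) (i : 'I_N) (y : N.-tuple R) : R :=
  k.+1%:R^-1 * (\sum_(j | j \notin csupp f) tnth (xhat y) j ^+ 2)
  + (tnth (code_vec f) i - tnth (xhat y) i) ^+ 2.

Lemma local_risk_ge0 f i y : 0 <= local_risk f i y.
Proof.
rewrite addr_ge0 ?sqr_ge0// mulr_ge0// sumr_ge0// => j _; exact: sqr_ge0.
Qed.

Lemma sum_local_risk f y : #|csupp f| = k.+1 ->
  \sum_(i in csupp f) local_risk f i y = sqnorm2 N (vsub N (code_vec f) (xhat y)).
Proof.
move=> fk; rewrite big_split/= sumr_const fk -[_ *+ _]mulr_natl mulrA divff//.
rewrite mul1r addrC /sqnorm2 [RHS](bigID (fun i => i \in csupp f))/=.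
congr (_ + _); apply: eq_bigr => i; rewrite [in RHS]tnth_mktuple//.
by rewrite inE negbK tnth_mktuple => /eqP ->; rewrite sub0r sqrrN.
Qed.

Lemma measurable_local_risk f i : measurable_fun setT (local_risk f i).
Proof.
have m j : measurable_fun setT (fun y => tnth (xhat y) j).
  by move/measurable_fun_tnthP : mxhat; apply.
apply: measurable_funD; last by apply: measurable_funX; exact: measurable_funB.
apply: measurable_funM => //; rewrite (_ : (fun y => _) =
    fun y => \sum_j (if j \notin csupp f then tnth (xhat y) j ^+ 2 else 0)).
  apply: measurable_sum => j; case: (j \notin _) => //; exact: measurable_funX.
by apply/funext => y; rewrite big_mkcond.
Qed.

Lemma measurable_vadd (x : N.-tuple R) : measurable_fun setT (vadd N x).
Proof.
apply/measurable_fun_tnthP => i.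
rewrite (_ : _ \o _ = fun w => tnth x i + tnth w i).
  by apply: measurable_funD => //; exact: measurable_tnth.
by apply/funext => w /=; rewrite tnth_mktuple.
Qed.

Lemma vadd_vshift (x w : N.-tuple R) j v :
  vadd N (vshift N j v x) w = vadd N x (vshift N j v w).
Proof.
apply: eq_from_tnth => i; rewrite !tnth_mktuple.
by case: ifP => // _; rewrite addrAC addrA.
Qed.

Local Open Scope ereal_scope.

(** The added entry is moved from the signal to the noise and from there into a weight. All
    candidates extending [f] are thus compared under the law of a single observation. *)
Lemma gauss_expect_local_risk (f : sparse_code) j m : f j = None ->
  gauss_expect N s (fun w =>
    (local_risk (upd f j (Some m)) j (vadd N (code_vec (upd f j (Some m))) w))%:E) =
  gauss_expect N s (fun w => (likelihood s U`_m (tnth w j) *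
    local_risk (upd f j (Some m)) j (vadd N (code_vec f) w))%:E).
Proof.
move=> fj; rewrite code_vec_upd//.
under eq_gauss_expect do rewrite vadd_vshift.
rewrite (gauss_expect_shift s N j U`_m (fun w =>
  (local_risk (upd f j (Some m)) j (vadd N (code_vec f) w))%:E))//.
- apply/measurable_EFinP; apply: measurableT_comp => //.
    exact: measurable_local_risk.
  exact: measurable_vadd.
- by move=> w; rewrite lee_fin local_risk_ge0.
Qed.

(** This is [pointwise_bound] integrated over the noise. The likelihoods have mean [1], and each of
    the [(N - k) * size U] pairs costs at most [2 * A ^+ 2 * eps] through its tail. *)
Lemma local_risk_lower_bound (f : sparse_code) : #|csupp f| = k ->
  \sum_(p : 'I_N * 'I_(size U) | f p.1 == None) (U`_p.2 ^+ 2)%:E <=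
  \sum_(p : 'I_N * 'I_(size U) | f p.1 == None)
    gauss_expect N s (fun w => (local_risk (upd f p.1 (Some p.2)) p.1
      (vadd N (code_vec (upd f p.1 (Some p.2))) w))%:E)
  + (((N - k) * size U)%:R * (2 * A ^+ 2 * eps)
     + (size U)%:R * k.+1%:R * A ^+ 2 * L)%:E.
Proof.
move=> fk.
have nU (m : 'I_(size U)) : (`|U`_m| <= A)%R by apply: UA; exact: mem_nth.
have nU2 (m : 'I_(size U)) : (U`_m ^+ 2 <= A ^+ 2)%R.
  by rewrite -(real_normK (num_real U`_m)) lerXn2r// nnegrE// (le_trans _ (nU m)).
pose l (w : N.-tuple R) (p : 'I_N * 'I_(size U)) :=
  likelihood s U`_p.2 (tnth w p.1).
pose h (w : N.-tuple R) (p : 'I_N * 'I_(size U)) :=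
  tail_weight s eta rho U`_p.2 (tnth w p.1).
pose g p w := local_risk (upd f p.1 (Some p.2)) p.1 (vadd N (code_vec f) w).
pose B : R := ((size U)%:R * k.+1%:R * A ^+ 2 * L)%R.
have B0 : (0 <= B)%R.
  by apply: mulr_ge0 (expR_ge0 _); apply: mulr_ge0 (sqr_ge0 _); exact: mulr_ge0.
have ml p : measurable_fun setT (fun w => (l w p)%:E).
  by apply: measurable_comp_tnth; exact: measurable_likelihood.
have mh p : measurable_fun setT (fun w => (h w p)%:E).
  by apply: measurable_comp_tnth; exact: measurable_tail_weight.
have mg p : measurable_fun setT (fun w => (g p w)%:E).
  apply/measurable_EFinP; apply: measurableT_comp => //.
    exact: measurable_local_risk.
  exact: measurable_vadd.
have l0 w p : (0 <= l w p)%R by exact: expR_ge0.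
have h0 w p : (0 <= h w p)%R by exact: expR_ge0.
have g0 p w : (0 <= g p w)%R by exact: local_risk_ge0.
have mlg p : measurable_fun setT (fun w => (l w p * g p w)%:E).
  by apply: (@emeasurable_funM _ _ _ _ (fun w => (l w p)%:E) (fun w => (g p w)%:E)).
have mlh p : measurable_fun setT (fun w => (l w p * h w p)%:E).
  by apply: (@emeasurable_funM _ _ _ _ (fun w => (l w p)%:E) (fun w => (h w p)%:E)).
have pointwise w :
    \sum_(p : 'I_N * 'I_(size U) | f p.1 == None)
      (U`_p.2 ^+ 2)%:E * (l w p)%:E <=
    \sum_(p : 'I_N * 'I_(size U) | f p.1 == None) ((l w p * g p w)%:E +
       (2 * U`_p.2 ^+ 2)%:E * (l w p * h w p)%:E) + B%:E.
  (* As [k < N], some position of [f] is free, so the sum of the likelihoods is not empty. *)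
  have [i0 fi0] : exists i0, f i0 == None.
    apply/existsP; apply: contraLR kN; rewrite negb_exists => /forallP H.
    rewrite -leqNgt -fk (_ : csupp f = [set: 'I_N]%SET).
      by rewrite cardsT card_ord leqW.
    by apply/setP => i; rewrite !inE H.
  have := @pointwise_bound R 'I_N 'I_(size U) (fun i => f i == None) i0
    (Ordinal U_gt0) (fun m => U`_m) (l w) (h w)
    (fun i => tnth (xhat (vadd N (code_vec f) w)) i) k.+1%:R A L fi0.
  rewrite card_ord -/B => bound.
  under eq_bigr do rewrite -EFinM mulrC.
  under [in leRHS]eq_bigr do rewrite -EFinM -EFinD mulrCA -mulrDr.
  rewrite !sumEFin -EFinD lee_fin; apply: le_trans (bound _ _ _ _ _ _) _ => //.
  - by rewrite ler_nat.
  - by move=> p; exact: expR_gt0.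
  - exact: expR_ge0.
  - by move=> p; exact: likelihood_or_tail.
  rewrite lerD2r le_eqVlt; apply/orP; left; apply/eqP.
  apply: eq_bigr => -[j m] /= fj.
  congr (_ * (_ + _))%R; rewrite /g /local_risk /=.
  congr (_ * _ + (_ - _) ^+ 2)%R; last by rewrite tnth_mktuple ffunE eqxx.
  (* Outside the support of the updated code lie the free positions of [f] other than [j]. *)
  by apply: eq_bigl => i; rewrite !inE ffunE negbK; case: (eqVneq i j) => _;
    rewrite ?andbT ?andbF.
have int_l (p : 'I_N * 'I_(size U)) : gauss_expect N s (fun w => (l w p)%:E) = 1.
  exact: gauss_expect_likelihood.
have -> : \sum_(p : 'I_N * 'I_(size U) | f p.1 == None) (U`_p.2 ^+ 2)%:E =
    gauss_expect N s (fun w =>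
      \sum_(p : 'I_N * 'I_(size U) | f p.1 == None)
        (U`_p.2 ^+ 2)%:E * (l w p)%:E).
  rewrite gauss_expect_sum.
  - apply: eq_bigr => p _; rewrite gauss_expectZl ?sqr_ge0//.
      by rewrite int_l mule1.
    by move=> w; rewrite lee_fin.
  - by move=> p _; exact: measurable_funeM.
  - by move=> p w _; rewrite mule_ge0 ?lee_fin ?sqr_ge0.
have m_lhs : measurable_fun setT (fun w =>
    \sum_(p : 'I_N * 'I_(size U) | f p.1 == None)
      (U`_p.2 ^+ 2)%:E * (l w p)%:E).
  by apply: emeasurable_big_sum => p _; exact: measurable_funeM.
have u20 (m : 'I_(size U)) : (0 <= 2 * U`_m ^+ 2)%R.
  by apply: mulr_ge0 => //; exact: sqr_ge0.
have m_tail (p : 'I_N * 'I_(size U)) : measurable_fun setT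
    (fun w => (2 * U`_p.2 ^+ 2)%:E * (l w p * h w p)%:E).
  exact: measurable_funeM.
have tail0 (p : 'I_N * 'I_(size U)) w :
    0 <= (2 * U`_p.2 ^+ 2)%:E * (l w p * h w p)%:E.
  by apply: mule_ge0; rewrite lee_fin// mulr_ge0.
have lg0 (p : 'I_N * 'I_(size U)) w : 0 <= (l w p * g p w)%:E.
  by rewrite lee_fin mulr_ge0.
have m_term (p : 'I_N * 'I_(size U)) : measurable_fun setT
    (fun w => (l w p * g p w)%:E + (2 * U`_p.2 ^+ 2)%:E * (l w p * h w p)%:E).
  exact: emeasurable_funD.
have m_rhs : measurable_fun setT (fun w =>
    \sum_(p : 'I_N * 'I_(size U) | f p.1 == None) ((l w p * g p w)%:E +
       (2 * U`_p.2 ^+ 2)%:E * (l w p * h w p)%:E)).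
  by apply: emeasurable_big_sum => p _; exact: m_term.
apply: le_trans.
  apply: (le_gauss_expect s N _ _ _ _ _ pointwise) => //.
  - exact: emeasurable_funD.
  - move=> w; apply: sume_ge0 => p _.
    by rewrite mule_ge0// lee_fin ?sqr_ge0.
rewrite gauss_expectD//; last first.
  by move=> w; apply: sume_ge0 => p _; exact: adde_ge0.
rewrite gauss_expect_cst EFinD addeA leeD2r//.
rewrite gauss_expect_sum//; last by move=> p w _; exact: adde_ge0.
under eq_bigr do rewrite gauss_expectD//.
rewrite big_split/=; apply: leeD.
  apply: lee_sum => p /eqP fp; rewrite gauss_expect_local_risk//.
rewrite (_ : (_ * _)%R = \sum_(p : 'I_N * 'I_(size U) | f p.1 == None)
    (2 * A ^+ 2 * eps)%R)%R; last first.
  by rewrite sumr_const card_free_pairs fk mulr_natl.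
rewrite -sumEFin; apply: lee_sum => p _.
rewrite gauss_expectZl//; last by move=> w; rewrite lee_fin mulr_ge0.
rewrite (EFinM (2 * A ^+ 2) eps); apply: lee_pmul; rewrite ?lee_fin//.
- by apply: gauss_expect_ge0 => w; rewrite lee_fin mulr_ge0.
- by rewrite ler_pM2l.
- exact: gauss_expect_tail.
Qed.


Lemma sum_risk_lower_bound :
  \sum_(f : sparse_code | #|csupp f| == k.+1) (sqnorm2 N (code_vec f))%:E <=
  \sum_(f : sparse_code | #|csupp f| == k.+1) gauss_expect N s (fun w =>
    (sqnorm2 N (vsub N (code_vec f) (xhat (vadd N (code_vec f) w))))%:E)
  + (#|[pred f : sparse_code | #|csupp f| == k.+1]|%:R *
     (k.+1%:R * (2 * A ^+ 2 * eps + A ^+ 2 * L * (k.+1%:R / (N - k)%:R))))%:E.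
Proof.
have -> : \sum_(f : sparse_code | #|csupp f| == k.+1)
    (sqnorm2 N (code_vec f))%:E = \sum_(f : sparse_code | #|csupp f| == k)
    \sum_(p : 'I_N * 'I_(size U) | f p.1 == None) (U`_p.2 ^+ 2)%:E.
  transitivity (\sum_(f : sparse_code | #|csupp f| == k.+1)
      \sum_(i in csupp f) (tnth (code_vec f) i ^+ 2)%:E).
    apply: eq_bigr => f _; rewrite sum_csuppE ?sumEFin// => i fi.
    by rewrite tnth_mktuple fi expr0n.
  rewrite sum_supp_reindex//; apply: eq_bigr => f _; apply: eq_bigr => p _.
  by rewrite tnth_mktuple ffunE eqxx.
have -> : \sum_(f : sparse_code | #|csupp f| == k.+1) gauss_expect N s (fun w =>
    (sqnorm2 N (vsub N (code_vec f) (xhat (vadd N (code_vec f) w))))%:E) =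
    \sum_(f : sparse_code | #|csupp f| == k)
    \sum_(p : 'I_N * 'I_(size U) | f p.1 == None)
    gauss_expect N s (fun w => (local_risk (upd f p.1 (Some p.2)) p.1
      (vadd N (code_vec (upd f p.1 (Some p.2))) w))%:E).
  transitivity (\sum_(f : sparse_code | #|csupp f| == k.+1)
      \sum_(i in csupp f) gauss_expect N s
        (fun w => (local_risk f i (vadd N (code_vec f) w))%:E)).
    apply: eq_bigr => f /eqP fk; rewrite -gauss_expect_sum.
    - apply: eq_gauss_expect => w.
      by rewrite sumEFin sum_local_risk.
    - move=> i _; apply/measurable_EFinP; apply: measurableT_comp => //.
        exact: measurable_local_risk.
      exact: measurable_vadd.
    - by move=> i w _; rewrite lee_fin local_risk_ge0.
  exact: (sum_supp_reindex U N _ k (fun f i => gauss_expect N s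
        (fun w => (local_risk f i (vadd N (code_vec f) w))%:E))).
pose n := #|[pred f : sparse_code | #|csupp f| == k.+1]|.
pose n' := #|[pred f : sparse_code | #|csupp f| == k]|.
(* This count converts an error per erased code into an error per code; the factor [size U]
   cancels. *)
have nE : (n%:R * k.+1%:R = n'%:R * ((N - k)%:R * (size U)%:R) :> R)%R.
  by rewrite -!natrM card_code_rec.
have Nk : (0 < (N - k)%:R :> R)%R.
  by rewrite ltr0n subn_gt0 (ltn_trans _ kN).
rewrite [X in X%:E](_ : _ = \sum_(f : sparse_code | #|csupp f| == k)
    (((N - k) * size U)%:R * (2 * A ^+ 2 * eps)
     + (size U)%:R * k.+1%:R * A ^+ 2 * L))%R.
  rewrite -sumEFin -big_split/=; apply: lee_sum => f /eqP.
  exact: local_risk_lower_bound.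
rewrite sumr_const -/n -/n' -[RHS]mulr_natl mulrA nE natrM.
by field; rewrite gt_eqF.
Qed.

Lemma risk_lower_bound :
  energy U k.+1 N <=
  unif_expect N (Xset U k.+1 N) (fun x => gauss_expect N s (fun w =>
    (sqnorm2 N (vsub N x (xhat (vadd N x w))))%:E))
  + (k.+1%:R * (2 * A ^+ 2 * eps + A ^+ 2 * L * (k.+1%:R / (N - k)%:R)))%:E.
Proof.
have := sum_risk_lower_bound; rewrite /energy /unif_expect !sum_Xset//.
set err := (k.+1%:R * _)%R; set n := #|_|.
have -> : (\sum_(f : sparse_code | #|csupp f| == k.+1) 1 = n%:R :> R)%R.
  by rewrite sumr_const.
have err0 : (0 <= err)%R.
  rewrite /err; apply: mulr_ge0 => //.
  by apply: addr_ge0; apply: mulr_ge0;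
    rewrite ?expR_ge0// mulr_ge0 ?sqr_ge0 ?expR_ge0.
have [n0|n0] := posnP n.
  by rewrite n0 invr0 !mule0 add0e lee_fin.
have nR0 : (0 < n%:R :> R)%R by rewrite ltr0n.
move=> /(@lee_wpmul2r _ n%:R^-1%:E) H; apply: le_trans (H _) _.
  by rewrite lee_fin invr_ge0.
(* The risk may be infinite, hence distributivity in its form for nonnegative terms. *)
rewrite ge0_muleDl; last 2 first.
- apply: sume_ge0 => f _; apply: gauss_expect_ge0 => w.
  by rewrite lee_fin sumr_ge0// => i _; exact: sqr_ge0.
- by rewrite lee_fin mulr_ge0.
by rewrite -EFinM [(n%:R * _)%R]mulrC mulfK// gt_eqF.
Qed.

End risk.

(** * Asymptotics in the ratio [N / k] *)

Lemma limn_einf_ge0 (R : realType) (u : (\bar R)^nat) :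
  (forall e : R, 0 < e -> \forall n \near \oo, (- e%:E <= u n)%E) ->
  (0 <= limn_einf u)%E.
Proof.
move=> H; rewrite limn_einf_lim; apply/lee_subgt0Pr => e /H [m _ um].
rewrite sub0e; apply: lime_ge; first exact: is_cvg_einfs.
exists m => // n /= mn; apply: le_ereal_inf_tmp => _ [p /= np <-].
exact/um/(leq_trans mn).
Qed.

Section umax.
Context {R : realType}.
Variable U : seq R.

Lemma le_umax v : v \in U -> `|v| <= umax U.
Proof. by 
move=> vU; exact: (@le_bigmax_seq _ _ _ _ 0 v xpredT (fun u => `|u|)).
Qed.

Lemma umax_gt0 : (0 < size U)%N -> 0 \notin U -> 0 < umax U.
Proof.
case: U le_umax => // v s le _; rewrite inE negb_or eq_sym => /andP[v0 _].
by apply: lt_le_trans (le v _); rewrite ?normr_gt0// mem_head.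
Qed.

End umax.

Section mse.
Context {R : realType}.
Variables (U : seq R) (sigma2 : R).
Hypothesis U_gt0 : (0 < size U)%N.
Hypothesis uU : uniq U.
Hypothesis U0 : 0 \notin U.
Hypothesis sigma2_gt : umax U ^+ 2 / 2 < sigma2.

(* Any value strictly between 0 and sigma2 - umax U ^+ 2 / 2 would do. *)
Let rho : R := (sigma2 - umax U ^+ 2 / 2) / 2.
(** With [l = ln (N / k)], the Chernoff bound becomes [expR (- c * l)] and the truncation level
    times [k / N] becomes [expR (- d * l)]. That [d] is positive is where [umax U ^+ 2 / 2 < sigma2]
    enters. *)
Let c : R := rho ^+ 2 / (2 * umax U ^+ 2) / sigma2.
Let d : R := 1 - (umax U ^+ 2 / 2 + rho) / sigma2.

Definition mse_gap (l : R) : R :=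
  2 * umax U ^+ 2 * (expR (- c * l) + expR (- d * l)).

Lemma mse_lower_bound (N k : nat) (xhat : N.-tuple R -> N.-tuple R) :
  (1 < k < N)%N -> measurable_fun setT xhat -> ln 2 <= ln (N%:R / k%:R : R) ->
  (energy U k N <= mse U sigma2 k N xhat
     + (k%:R * mse_gap (ln (N%:R / k%:R)))%:E)%E.
Proof.
move=> /andP[k1 kN] mxhat; set l := ln (_ / _) => l2.
have A0 := umax_gt0 U U_gt0 U0.
have A20 : 0 < umax U ^+ 2 by rewrite exprn_gt0.
have sigma0 : 0 < sigma2 by rewrite (lt_trans _ sigma2_gt)// divr_gt0.
have rho0 : 0 < rho by rewrite divr_gt0// subr_gt0.
have kR : 0 < k%:R :> R by rewrite ltr0n ltnW.
have NR : 0 < N%:R :> R by rewrite ltr0n (leq_ltn_trans _ kN).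
have l0 : 0 < l by apply: ln_gt0; rewrite ltr_pdivlMr// mul1r ltr_nat.
have el : expR l = N%:R / k%:R by rewrite lnK// posrE divr_gt0.
have N2k : 2 * k%:R <= N%:R :> R.
  by rewrite -ler_pdivlMr// -el -[X in X <= _]lnK ?posrE// ler_expR.
set s := noise_sd sigma2 k N.
have s2 : s ^+ 2 = sigma2 / l by rewrite sqr_sqrtr// divr_ge0// ltW.
have s0 : s != 0 by rewrite gt_eqF// sqrtr_gt0 divr_gt0.
have [k' kE] : exists k', k = k'.+1 by case: (k) k1 => // k' _; exists k'.
(* The minimiser of [eta ^+ 2 * umax U ^+ 2 / 2 - eta * rho], with minimum
   [- rho ^+ 2 / (2 * umax U ^+ 2)]. *)
pose eta := rho / umax U ^+ 2.
have := @risk_lower_bound R U N k' s (umax U) rho eta xhat U0 uU U_gt0.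
rewrite -kE => /(_ _ _ s0 (le_umax U) _ mxhat) H.
apply: le_trans (H _ _ _) _ => //.
- by rewrite -ltnS -kE.
- by rewrite divr_ge0// ltW.
rewrite leeD2l// lee_fin ler_pM2l// /mse_gap mulrDr; apply: lerD.
  rewrite ler_pM2l ?mulr_gt0// ler_expR s2 /eta /c.
  rewrite le_eqVlt; apply/orP; left; apply/eqP; field.
  by rewrite !gt_eqF.
have -> : expR (- d * l) =
    expR ((umax U ^+ 2 / 2 + rho) / s ^+ 2) * (k%:R / N%:R).
  rewrite -[k%:R / _]invf_div -el -expRN -expRD; congr expR.
  by rewrite s2 /d; field; rewrite !gt_eqF.
(* From [2 * k <= N]; this loss of a factor [2] gives the second exponential in [mse_gap] its
   coefficient. *)
have Nk : N%:R / 2 <= (N - k')%:R :> R.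
  rewrite natrB; last by rewrite ltnW// (ltn_trans _ kN)// kE.
  have : k'%:R <= k%:R :> R by rewrite ler_nat kE.
  by lra.
rewrite [leRHS](_ : _ = umax U ^+ 2 * expR ((umax U ^+ 2 / 2 + rho) / s ^+ 2)
    * (k%:R / (N%:R / 2))); last by rewrite invf_div; ring.
rewrite ler_pM2l ?mulr_gt0 ?expR_gt0// ler_pM2l// lef_pV2 ?posrE ?divr_gt0//.
by apply: lt_le_trans Nk; rewrite divr_gt0.
Qed.

Lemma mse_gap_small (e : R) : 0 < e -> exists B : R, forall l, B <= l ->
  mse_gap l <= e.
Proof.
move=> e0.
have A20 : 0 < umax U ^+ 2 by rewrite exprn_gt0// umax_gt0.
have sigma0 : 0 < sigma2 by rewrite (lt_trans _ sigma2_gt)// divr_gt0.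
have rho0 : 0 < rho by rewrite divr_gt0// subr_gt0.
have c0 : 0 < c by rewrite !divr_gt0 ?exprn_gt0// mulr_gt0.
have d0 : 0 < d.
  by rewrite subr_gt0 ltr_pdivrMr// mul1r /rho; move: sigma2_gt; lra.
(* Two exponentials of size at most [b] give a gap of at most [4 * umax U ^+ 2 * b = e]. *)
pose b := e / (4 * umax U ^+ 2).
have b0 : 0 < b by rewrite divr_gt0// mulr_gt0.
have small (a l : R) : 0 < a -> - ln b / a <= l -> expR (- a * l) <= b.
  move=> a0; rewrite ler_pdivrMr// => H.
  by rewrite -[leRHS]lnK ?posrE// ler_expR mulNr lerNl mulrC.
exists (Num.max (- ln b / c) (- ln b / d)) => l.
rewrite ge_max => /andP[lc ld].
apply: (@le_trans _ _ (2 * umax U ^+ 2 * (b + b))).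
  have A2 : 0 < 2 * umax U ^+ 2 by apply: mulr_gt0.
  by rewrite /mse_gap ler_pM2l//; apply: lerD; exact: small.
rewrite le_eqVlt; apply/orP; left; apply/eqP; rewrite /b; field.
by rewrite gt_eqF// umax_gt0.
Qed.

Lemma energy_fin_num N k : (energy U k N \is a fin_num)%E.
Proof. by rewrite /energy /unif_expect sum_Xset// sumEFin. Qed.

End mse.

(** Eventually [ln k] is below half of [ln N], so [ln (N / k)] exceeds the other half, which tends
    to infinity. *)
Lemma ln_ratio_cvgy (R : realType) (gamma : R) (kn Nn : nat -> nat) :
  gamma < 2^-1 -> (forall n, 1 <= kn n < Nn n)%N ->
  (fun n => (Nn n)%:R : R) @ \oo --> +oo ->
  (fun n => ln ((kn n)%:R : R) / ln ((Nn n)%:R : R)) @ \oo --> gamma ->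
  forall B : R, \forall n \near \oo, B <= ln ((Nn n)%:R / (kn n)%:R : R).
Proof.
move=> gamma2 kN Ny kNgamma B.
have /cvgryPge/(_ (expR (2 * B))) HN := Ny.
have Hg := cvgr_lt gamma kNgamma 2^-1 gamma2.
near=> n.
have /andP[k1 kNn] := kN n.
have kR : 0 < (kn n)%:R :> R by rewrite ltr0n.
have N1 : 1 < (Nn n)%:R :> R by rewrite ltr1n (leq_ltn_trans k1).
have N0 : 0 < (Nn n)%:R :> R by exact: lt_trans N1.
have lN : 0 < ln (Nn n)%:R :> R by rewrite ln_gt0.
have h1 : 2 * B <= ln ((Nn n)%:R : R).
  by rewrite -ler_expR lnK ?posrE//; near: n; exact: HN.
have h2 : ln ((kn n)%:R : R) < 2^-1 * ln ((Nn n)%:R : R).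
  by rewrite -ltr_pdivrMr//; near: n; exact: Hg.
rewrite ln_div ?posrE//; lra.
Unshelve. all: by end_near. Qed.

Theorem theorem2 (R : realType) (U : seq R) (sigma2 gamma : R)
  (kn Nn : nat -> nat)
  (xhat : forall n : nat, (Nn n).-tuple R -> (Nn n).-tuple R) :
  (0 < size U)%N -> uniq U -> 0 \notin U ->
  0 < sigma2 ->
  umax U ^+ 2 / 2 < sigma2 ->
  (forall n, 1 <= kn n < Nn n)%N ->
  (forall n, measurable_fun [set: (Nn n).-tuple R] (xhat n)) ->
  (fun n => (kn n)%:R : R) @ \oo --> +oo ->
  (fun n => (Nn n)%:R : R) @ \oo --> +oo ->
  (fun n => ln ((kn n)%:R : R) / ln ((Nn n)%:R : R)) @ \oo --> gamma ->
  gamma < Num.min (C0 U sigma2 / (C0 U sigma2 + sigma2 / (umax U * umin U)))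
            (Num.min (C1 U sigma2 / (C1 U sigma2 + 3)) (2^-1)) ->
  (0 <= limn_einf (fun n =>
      (((kn n)%:R^-1 : R)%:E
       * (mse U sigma2 (kn n) (Nn n) (xhat n) - energy U (kn n) (Nn n))))%E)%E.
Proof.
move=> U_gt0 uU U0 _ sigma2_gt kN mxhat ky Ny kNgamma.
rewrite !lt_min => /and3P[_ _ gamma2].
have Hl := ln_ratio_cvgy R gamma kn Nn gamma2 kN Ny kNgamma.
apply: limn_einf_ge0 => e e0.
have [B HB] := mse_gap_small U sigma2 U_gt0 U0 sigma2_gt e e0.
(* The finite bound asks for [k] at least [2], so that an erased signal keeps a nonzero entry. *)
have /cvgryPge/(_ 2) Hk := ky.
have HlB := Hl B; have Hl2 := Hl (ln 2).
near=> n.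
have k2 : (1 < kn n < Nn n)%N.
  have /andP[_ ->] := kN n; rewrite andbT -(@ler_nat R); near: n; exact: Hk.
have l2 : ln 2 <= ln ((Nn n)%:R / (kn n)%:R : R) by near: n; exact: Hl2.
have lB : B <= ln ((Nn n)%:R / (kn n)%:R : R) by near: n; exact: HlB.
have kR : 0 < (kn n)%:R :> R by rewrite ltr0n; case/andP: k2 => /ltnW.
have := mse_lower_bound U sigma2 U_gt0 uU U0 sigma2_gt _ _ _ k2 (mxhat n) l2.
(* Finiteness of the energy allows moving it across the inequality even when [mse] is infinite. *)
have fin := energy_fin_num U uU U0 (Nn n) (kn n).
set g := mse_gap _ _ _ => H.
rewrite -(@lee_pmul2l _ (kn n)%:R%:E)// ?lte_fin//.
rewrite [leRHS]muleA (_ : (kn n)%:R%:E * (kn n)%:R^-1%:E = 1%:E)%E; last first.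
  by rewrite -EFinM mulfV ?gt_eqF.
rewrite mul1e leeBrDr// addeC.
rewrite muleN leeBlDr//; apply: le_trans H _.
by rewrite leeD2l// -EFinM lee_fin ler_pM2l// HB.
Unshelve. all: by end_near. Qed.
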